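(* Let $0<\alpha<1$, $T>0$ and $J=[0,T]$. If $m:J\to\mathbb{R}$ is any differentiable function such that ${}^{ABC}{}_0\mathcal{D}_\tau^\alpha m\in C(J)$ and there exists $\tau_0\in(0,T]$ with $m(\tau_0)=0$ and $m(\tau)\le 0$ for all $\tau\in[0,\tau_0)$, then ${}^{ABC}{}_0\mathcal{D}_\tau^\alpha m(\tau_0)\ge 0$.
   Context: Let $0<\alpha<1$ and let $B$ be a fixed normalization function on $[0,1]$ with $B(\alpha)>0$ and $B(0)=B(1)=1$. The one-parameter Mittag-Leffler function is $\mathbb{E}_\alpha(z)=\sum_{n=0}^\infty \frac{z^n}{\Gamma(n\alpha+1)}$. For $\omega\in H^1(0,T)$ (Sobolev space), the left Atangana--Baleanu--Caputo (ABC) fractional derivative of order $\alpha$ is ${}^{ABC}{}_0\mathcal{D}_\tau^\alpha\omega(\tau)=\frac{B(\alpha)}{1-\alpha}\int_0^\tau \mathbb{E}_\alpha\left[-\frac{\alpha}{1-\alpha}(\tau-\sigma)^\alpha\right]\omega'(\sigma)\,d\sigma$. Functions to which this operator is applied are understood to lie in its domain. $C(J)$ denotes the real continuous functions on $J$. *)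

(* Defs.v *)
From HB Require Import structures.
From mathcomp Require Import all_boot all_order all_algebra.
From mathcomp Require Import all_classical all_reals all_analysis.

Set Implicit Arguments.
Unset Strict Implicit.
Unset Printing Implicit Defensive.

Import Order.TTheory GRing.Theory Num.Theory.
Import numFieldNormedType.Exports.

Local Open Scope classical_set_scope.
Local Open Scope ring_scope.

(* Meaningful for x > 0; only the values at n * alpha + 1 >= 1 are used. *)
Definition Gamma {R : realType} (x : R) : R :=
  \int[lebesgue_measure]_(t in `]0, +oo[) (t `^ (x - 1) * expR (- t)).

Definition mittag_leffler {R : realType} (alpha z : R) : R :=
  limn (series (fun n : nat => z ^+ n / Gamma (n%:R * alpha + 1))).

(* The difference quotient only sees points of J, so that on `[0, T] the
   derivatives at the end points are one-sided. *)
Definition differentiable_on {R : realType} (J : set R) (f : R -> R) : Prop :=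
  forall x, J x -> cvg ((f y - f x) / (y - x) @[y --> within J x^']).

Definition test_function {R : realType} (U : set R) (phi : R -> R) : Prop :=
  (forall n x, derivable (derive1n n phi) x 1) /\
  (exists K : set R, [/\ compact K, K `<=` U & forall x, ~ K x -> phi x = 0]).

Definition weak_derivative {R : realType} (U : set R) (f g : R -> R) : Prop :=
  forall phi, test_function U phi ->
    \int[lebesgue_measure]_(x in U) (f x * derive1 phi x) =
    - \int[lebesgue_measure]_(x in U) (g x * phi x).

(* f \_ U is f on U and 0 elsewhere: membership of f \_ U in L^2(R) is
   membership of f in L^2(U). *)
Definition L2 {R : realType} (U : set R) (f : R -> R) : Prop :=
  f \_ U \in Lfun (@lebesgue_measure R) 2%:E.

Definition H1 {R : realType} (U : set R) (f : R -> R) : Prop :=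
  L2 U f /\ exists2 g, L2 U g & weak_derivative U f g.

(* An element of H^1(0, T) is represented by its absolutely continuous
   version, whose pointwise derivative exists a.e. and is the weak one.  The
   interval of integration is open because derive1 f at 0 and T would involve
   values of f outside `[0, T]. *)
Definition ABC_derivative {R : realType} (B : R -> R) (alpha : R) (f : R -> R)
    (tau : R) : R :=
  B alpha / (1 - alpha) *
  \int[lebesgue_measure]_(sigma in `]0, tau[)
    (mittag_leffler alpha (- (alpha / (1 - alpha)) * (tau - sigma) `^ alpha)
     * derive1 f sigma).

(* Main.v *)
Require Import Defs.
From HB Require Import structures.
From mathcomp Require Import all_boot all_order all_algebra.
From mathcomp Require Import all_classical all_reals all_analysis.
From mathcomp Require Import measurable_realfun.
From mathcomp Require Import ring lra.

Import Order.TTheory GRing.Theory Num.Theory.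
Import numFieldNormedType.Exports.

Local Open Scope classical_set_scope.
Local Open Scope ring_scope.

(** Put lambda = alpha / (1 - alpha) and
    w sigma = E_alpha (- lambda (tau0 - sigma)^alpha).  Up to a positive factor
    the ABC derivative at tau0 is the integral of w m' over ]0, tau0[.  If w is
    nonnegative and nondecreasing, integration by parts makes it equal to
    w(tau0) m(tau0) - w(0) m(0) - (integral of m dw), in which the first term
    vanishes and the other two are nonnegative because m <= 0.  Two things make
    this a proof.

    Sign and monotonicity of E_alpha on the negative half-line
    ([mittag_leffler_ge0], [mittag_leffler_nonincreasing]).  The function
    t |-> E_alpha (- lambda t^alpha) solves D^alpha u = - lambda u (Caputo),
    u(0) = 1.  The implicit Gruenwald-Letnikov scheme for this equation, whose
    difference operator has the generating function (1 - z)^alpha, has the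
    solution with generating function
      (1 - z)^(alpha - 1) / (mu + (1 - z)^alpha),   mu = lambda h^alpha.
    Since 0 < alpha < 1, every nonconstant coefficient of (1 - z)^alpha is
    nonpositive and every coefficient of (1 - z)^(alpha - 1) is nonnegative, so
    the scheme is a recursion with nonnegative data in which mu occurs only
    through the factor 1 / (1 + mu): its solution is nonnegative and
    nonincreasing in mu ([discrete_ml_recursion], [discrete_ml_ge0],
    [discrete_ml_nonincreasing]).
    Expanding the generating function in powers of mu writes the solution as a
    series in j with the coefficients of (1 - z)^(- (j alpha + 1)), and Gauss's
    product formula for Gamma ([gauss_seq_cvg]) turns these into
    1 / Gamma (j alpha + 1) as the step tends to 0.  These approximations of
    1 / Gamma decrease, which provides the domination needed to pass to the
    limit under the sum ([mittag_leffler_cvg]).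

    Recovering an increment from a derivative that exists everywhere
    ([upper_derivate_le_integral], [weighted_derive_integral_ge0]).  A
    derivative that exists everywhere and is integrable satisfies the
    fundamental theorem of calculus.  Only one inequality is used here, and in
    a weighted form that makes the integration by parts superfluous: m <= 0
    and the monotonicity of w give
      w(y) m(y) - w(x) m(x) <= w(x) (m(y) - m(x))   for x <= y,
    so that the right upper derivate of w m is at most w m', hence the
    increment of w m over [a, b] is at most the integral of w m'.  This
    increment is at least w(b) m(b), which tends to 0 as b tends to tau0.
    When w m' is not integrable, its real-valued integral is 0 by
    convention. *)

(** * Coefficients of the binomial series *)

(** The coefficient of z^n in (1 - z)^(- s), i.e. the rising factorial
    s (s + 1) ... (s + n - 1) divided by n!. *)
Definition negbin {R : realType} (s : R) (n : nat) : R :=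
  \prod_(i < n) ((i%:R + s) / i.+1%:R).

Lemma negbin0 (R : realType) (s : R) : negbin s 0 = 1.
Proof. by rewrite /negbin big_ord0. Qed.

Lemma negbinS (R : realType) (s : R) (n : nat) :
  negbin s n.+1 = negbin s n * ((n%:R + s) / n.+1%:R).
Proof. by rewrite /negbin big_ord_recr. Qed.

Lemma negbinS_mul (R : realType) (s : R) (n : nat) :
  n.+1%:R * negbin s n.+1 = (n%:R + s) * negbin s n.
Proof.
have n0 : n.+1%:R != 0 :> R by rewrite pnatr_eq0.
by rewrite negbinS; field.
Qed.

Lemma negbin_ge0 (R : realType) (s : R) (n : nat) : 0 <= s -> 0 <= negbin s n.
Proof.
move=> s0; apply: prodr_ge0 => i _.
by rewrite divr_ge0// addr_ge0.
Qed.

Lemma negbin_gt0 (R : realType) (s : R) (n : nat) : 0 < s -> 0 < negbin s n.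
Proof.
move=> s0; apply: prodr_gt0 => i _.
by rewrite divr_gt0// ltr_wpDl.
Qed.

(** Only the factor of index 0 can be negative. *)
Lemma negbin_le0 (R : realType) (s : R) (n : nat) :
  0 <= s -> s <= 1 -> negbin (- s) n.+1 <= 0.
Proof.
move=> s0 s1; elim: n => [|n IHn].
  by rewrite negbinS negbin0 mul1r add0r divr1 oppr_le0.
rewrite negbinS mulr_le0_ge0// divr_ge0// -natr1.
have : 0 <= n%:R :> R by [].
by lra.
Qed.

(** (1 - z)^(- s) (1 - z)^(- t) = (1 - z)^(- (s + t)), proved without
    generating functions: both sides satisfy the first-order recursion
    [negbinS_mul], the weight n + 1 being split as l + (n + 1 - l). *)
Lemma negbin_convolution (R : realType) (s t : R) (n : nat) :
  \sum_(l < n.+1) negbin s l * negbin t (n - l) = negbin (s + t) n.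
Proof.
elim: n => [|n IHn].
  by rewrite big_ord_recr big_ord0/= !negbin0 add0r mulr1.
have n0 : n.+1%:R != 0 :> R by rewrite pnatr_eq0.
apply: (mulfI n0); rewrite negbinS_mul -IHn !mulr_sumr.
have -> : \sum_(i < n.+2) n.+1%:R * (negbin s i * negbin t (n.+1 - i)) =
   \sum_(i < n.+2) (i%:R * negbin s i) * negbin t (n.+1 - i) +
   \sum_(i < n.+2) negbin s i * ((n.+1 - i)%:R * negbin t (n.+1 - i)).
  rewrite -big_split/=; apply: eq_bigr => i _.
  have le_in : (i <= n.+1)%N by rewrite -ltnS.
  by rewrite natrB//; ring.
rewrite big_ord_recl mul0r mul0r add0r [in X in _ + X]big_ord_recr/=.
rewrite subnn mul0r mulr0 addr0 -big_split/=; apply: eq_bigr => i _.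
have le_in : (i <= n)%N by rewrite -ltnS.
rewrite /bump/= add1n negbinS_mul subSS subSn// negbinS_mul natrB//.
by ring.
Qed.

(** Absorbs a linear factor into a slightly larger ratio. *)
Lemma linear_geometric_le (R : realType) (q r : R) (j : nat) : 0 <= q -> q < r ->
  (1 + j%:R) * q ^+ j <= r / (r - q) * r ^+ j.
Proof.
move=> q0 qr; have rq : 0 < r - q by rewrite subr_gt0.
suff H : (1 + j%:R) * (r - q) * q ^+ j <= r ^+ j.+1.
  rewrite -(ler_pM2l rq) (_ : (r - q) * (r / _ * _) = r ^+ j.+1).
    by apply: le_trans H; rewrite mulrA (mulrC (r - q)).
  by rewrite exprS; field; rewrite gt_eqF.
elim: j => [|j IHj]; first by rewrite addr0 mul1r mulr1 expr1; lra.
have h1 : q * ((1 + j%:R) * (r - q) * q ^+ j) <= q * r ^+ j.+1.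
  exact: ler_wpM2l.
have h2 : (r - q) * q ^+ j.+1 <= (r - q) * r ^+ j.+1.
  have qr' := ltW qr; have r0 := le_trans q0 qr'.
  by rewrite ler_pM2l//; apply: lerXn2r => //; rewrite nnegrE.
rewrite (_ : r ^+ j.+2 = q * r ^+ j.+1 + (r - q) * r ^+ j.+1); last first.
  by rewrite exprS; ring.
rewrite -natr1 (_ : _ * q ^+ _ = q * ((1 + j%:R) * (r - q) * q ^+ j) +
    (r - q) * q ^+ j.+1); last by rewrite exprS; ring.
exact: lerD.
Qed.

(** As a function of j the coefficient grows like a polynomial of degree n, so
    that any power series in rho < 1 with these coefficients is dominated by a
    geometric one. *)
Lemma negbin_geometric (R : realType) (alpha rho : R) (n : nat) :
  0 <= alpha <= 1 -> 0 <= rho < 1 ->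
  exists M q : R, [/\ 0 <= M, 0 <= q, q < 1 &
    forall j, rho ^+ j * negbin (j%:R * alpha + 1) n <= M * q ^+ j].
Proof.
move=> /andP[a0 a1] /andP[r0 r1]; elim: n => [|n [M [q [M0 q0 q1 IHn]]]].
  by exists 1, rho; split => // j; rewrite negbin0 mulr1 mul1r.
pose r := (q + 1) / 2.
have qr : q < r by rewrite /r; lra.
have r_gt0 : 0 < r := le_lt_trans q0 qr.
exists (M * (r / (r - q))), r; split; [| exact: ltW | |].
- by rewrite mulr_ge0// divr_ge0 ?subr_ge0// ltW.
- by rewrite /r; lra.
move=> j.
have ja0 : 0 <= j%:R * alpha by rewrite mulr_ge0.
have le1 : (n%:R + (j%:R * alpha + 1)) / n.+1%:R <= 1 + j%:R.
  rewrite ler_pdivrMr// -natr1.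
  have jn : 0 <= j%:R * n%:R :> R by rewrite mulr_ge0.
  have : j%:R * alpha <= j%:R by rewrite ler_piMr.
  by nra.
rewrite negbinS mulrA.
apply: (@le_trans _ _ (M * q ^+ j * (1 + j%:R))).
  apply: ler_pM => //.
    by rewrite mulr_ge0 ?exprn_ge0// negbin_ge0// addr_ge0.
  by rewrite divr_ge0// !addr_ge0.
rewrite -[leRHS]mulrA -[leLHS]mulrA ler_wpM2l// [leLHS]mulrC.
exact: linear_geometric_le.
Qed.

Lemma ler_negbin (R : realType) (s t : R) (n : nat) :
  0 <= s -> s <= t -> negbin s n <= negbin t n.
Proof.
move=> s0 st; apply: ler_prod => i _.
by rewrite divr_ge0 ?addr_ge0//= ler_pM2r ?invr_gt0// lerD2l.
Qed.

(** * Series dominated by a geometric series *)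

Lemma geometric_dominated_tail (R : realType) (u : R ^nat) (M q : R) (J K : nat) :
  0 <= q < 1 -> (forall j, `|u j| <= M * q ^+ j) -> (J <= K)%N ->
  `|series u K - series u J| <= M * q ^+ J / (1 - q).
Proof.
move=> /andP[q0 q1] uM JK.
have q1' : 0 < 1 - q by rewrite subr_gt0.
have M0 : 0 <= M by have := uM 0%N; rewrite expr0 mulr1; exact: le_trans.
suff H n : `|series u (J + n)%N - series u J| <=
    M * (q ^+ J - q ^+ (J + n)%N) / (1 - q).
  rewrite -(subnKC JK); apply: le_trans (H _) _.
  by rewrite ler_pM2r ?invr_gt0// ler_wpM2l// gerBl exprn_ge0.
elim: n => [|n IHn]; first by rewrite addn0 !subrr normr0 mulr0 mul0r.
have -> : series u (J + n.+1)%N - series u J =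
    (series u (J + n)%N - series u J) + u (J + n)%N.
  by rewrite /series/= addnS big_nat_recr//=; ring.
apply: le_trans (ler_normD _ _) _.
apply: le_trans (lerD IHn (uM _)) _.
rewrite addnS exprS le_eqVlt; apply/orP; left; apply/eqP.
by field; rewrite gt_eqF.
Qed.

Lemma geometric_dominated_cvg (R : realType) (u : R ^nat) (M q : R) :
  0 <= q < 1 -> (forall j, `|u j| <= M * q ^+ j) -> cvgn (series u).
Proof.
move=> /andP[q0 q1] uM; apply: normed_cvg.
apply: (@series_le_cvg _ _ (geometric M q)) => //.
- by move=> n; exact: normr_ge0.
- move=> n; rewrite /geometric/= mulr_ge0 ?exprn_ge0//.
  by have := uM 0%N; rewrite expr0 mulr1; exact: le_trans.
- by apply: is_cvg_geometric_series; rewrite ger0_norm.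
Qed.

Lemma geometric_dominated_lim_tail (R : realType) (u : R ^nat) (M q : R) (J : nat) :
  0 <= q < 1 -> (forall j, `|u j| <= M * q ^+ j) ->
  `|limn (series u) - series u J| <= M * q ^+ J / (1 - q).
Proof.
move=> q01 uM.
have cu := geometric_dominated_cvg _ _ _ _ q01 uM.
have cuJ : `|series u K - series u J| @[K --> \oo] -->
    `|limn (series u) - series u J|.
  by apply: cvg_norm; apply: cvgB => //; exact: cvg_cst.
rewrite -(cvg_lim _ cuJ)//; apply: limr_le.
  by apply/cvg_ex; exists (`|limn (series u) - series u J|).
by exists J => // K /= JK; exact: geometric_dominated_tail.
Qed.

(** Tannery's theorem: termwise limits of uniformly dominated series can be
    summed. *)
Lemma tannery (R : realType) (t : nat -> R ^nat) (u : R ^nat) (M q : R) :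
  0 <= q < 1 -> (\forall n \near \oo, forall j, `|t n j| <= M * q ^+ j) ->
  (forall j, t n j @[n --> \oo] --> u j) ->
  limn (series (t n)) @[n --> \oo] --> limn (series u).
Proof.
move=> q01 tM tu; have /andP[q0 q1] := q01.
have uM j : `|u j| <= M * q ^+ j.
  have h : `|t n j| @[n --> \oo] --> `|u j| by apply: cvg_norm; exact: tu.
  rewrite -(cvg_lim _ h)//; apply: limr_le.
    by apply/cvg_ex; exists `|u j|.
  by apply: filterS tM => n; exact.
have tail0 : M * q ^+ J / (1 - q) @[J --> \oo] --> 0.
  rewrite -(mul0r (1 - q)^-1); apply: cvgM; last exact: cvg_cst.
  by apply: cvg_geometric; rewrite ger0_norm.
apply/cvgrPdist_le => e e0; have e3 : 0 < e / 3 by rewrite divr_gt0.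
have [J _ HJ] := (cvgrPdist_le _ _).1 tail0 _ e3.
have {HJ} := HJ J (leqnn _); rewrite /= sub0r normrN => HJ.
have {}HJ : M * q ^+ J / (1 - q) <= e / 3 := le_trans (ler_norm _) HJ.
have SJ : series (t n) J @[n --> \oo] --> series u J.
  by apply: cvg_big => [|j _]; [exact: add_continuous|exact: tu].
have {}SJ := (cvgrPdist_le _ _).1 SJ _ e3.
near=> n.
have h1 : `|limn (series u) - series u J| <= e / 3.
  by apply: le_trans HJ; exact: geometric_dominated_lim_tail.
have h2 : `|limn (series (t n)) - series (t n) J| <= e / 3.
  apply: le_trans HJ; apply: geometric_dominated_lim_tail => //.
  by near: n.
have h3 : `|series u J - series (t n) J| <= e / 3 by near: n; exact: SJ.
rewrite (_ : _ - _ = (limn (series u) - series u J) +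
   (series u J - series (t n) J) - (limn (series (t n)) - series (t n) J));
  last by ring.
apply: le_trans (ler_normB _ _) _.
rewrite (_ : e = e / 3 + e / 3 + e / 3); last by field.
apply: lerD => //; apply: le_trans (ler_normD _ _) _.
exact: lerD.
Unshelve. all: by end_near. Qed.

(** * The implicit scheme for the fractional relaxation equation *)

Definition discrete_ml_term {R : realType} (alpha mu : R) (n j : nat) : R :=
  (- mu) ^+ j * negbin (j%:R * alpha + 1) n.

(** The n-th value of the scheme with parameter mu = lambda h^alpha, i.e. the
    coefficient of z^n in (1 - z)^(alpha - 1) / (mu + (1 - z)^alpha), expanded
    in powers of mu. *)
Definition discrete_ml {R : realType} (alpha mu : R) (n : nat) : R :=
  limn (series (discrete_ml_term alpha mu n)).

(** Multiplying the expansion by mu + (1 - z)^alpha makes it telescope: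
    (1 - z)^alpha lowers the exponent j alpha + 1 of the j-th term to that of
    the previous one, by [negbin_convolution]. *)
Lemma discrete_ml_partial_recursion (R : realType) (alpha mu : R) (n J : nat) :
  mu * series (discrete_ml_term alpha mu n) J +
    \sum_(l < n.+1) negbin (- alpha) l *
      series (discrete_ml_term alpha mu (n - l)) J =
  negbin (1 - alpha) n -
    (- mu) ^+ J * negbin (- alpha + (J%:R * alpha + 1)) n.
Proof.
elim: J => [|J IHJ].
  rewrite /series/= !big_geq// mulr0 add0r big1; last first.
    by move=> l _; rewrite big_geq// mulr0.
  by rewrite expr0 mul0r add0r mul1r [- alpha + 1]addrC subrr.
have sS k : series (discrete_ml_term alpha mu k) J.+1 =
    series (discrete_ml_term alpha mu k) J + discrete_ml_term alpha mu k J.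
  by rewrite /series/= big_nat_recr.
rewrite sS mulrDr.
have -> : \sum_(l < n.+1)
      negbin (- alpha) l * series (discrete_ml_term alpha mu (n - l)) J.+1 =
    \sum_(l < n.+1) negbin (- alpha) l *
      series (discrete_ml_term alpha mu (n - l)) J +
    (- mu) ^+ J * negbin (- alpha + (J%:R * alpha + 1)) n.
  rewrite -negbin_convolution mulr_sumr -big_split/=.
  by apply: eq_bigr => l _; rewrite sS /discrete_ml_term; ring.
rewrite addrACA IHJ /discrete_ml_term exprS.
rewrite (_ : - alpha + (J.+1%:R * alpha + 1) = J%:R * alpha + 1).
  by ring.
by rewrite -natr1; ring.
Qed.

Lemma discrete_ml_cvg (R : realType) (alpha mu : R) (n : nat) :
  0 <= alpha <= 1 -> 0 <= mu < 1 ->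
  series (discrete_ml_term alpha mu n) @ \oo --> discrete_ml alpha mu n.
Proof.
move=> a01 m01; have [M [q [M0 q0 q1 H]]] := negbin_geometric _ _ _ n a01 m01.
apply: (@geometric_dominated_cvg _ _ M q); first by rewrite q0.
move=> j; rewrite normrM normrX normrN.
have /andP[m0 _] := m01; have /andP[a0 _] := a01.
by rewrite (ger0_norm m0) ger0_norm// negbin_ge0// addr_ge0// mulr_ge0.
Qed.

(** The scheme solved for its latest value.  All coefficients on the right are
    nonnegative, which is what makes sign and monotonicity provable by
    induction on n. *)
Lemma discrete_ml_recursion (R : realType) (alpha mu : R) (n : nat) :
  0 <= alpha <= 1 -> 0 <= mu < 1 ->
  (1 + mu) * discrete_ml alpha mu n = negbin (1 - alpha) n +
    \sum_(l < n) - negbin (- alpha) l.+1 * discrete_ml alpha mu (n - l.+1).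
Proof.
move=> a01 m01; have /andP[a0 a1] := a01; have /andP[m0 m1] := m01.
pose S k J := series (discrete_ml_term alpha mu k) J.
have SC k : S k J @[J --> \oo] --> discrete_ml alpha mu k by exact: discrete_ml_cvg.
(* The boundary term of the telescoping sum. *)
have err0 : (- mu) ^+ J * negbin (- alpha + (J%:R * alpha + 1)) n @[J --> \oo]
    --> (0 : R).
  have [M [q [M0 q0 q1 H]]] := negbin_geometric _ _ _ n a01 m01.
  apply/norm_cvg0P; apply: (@squeeze_cvgr _ _ _ _ (cst 0) (geometric M q)).
  - near=> J; rewrite normr_ge0/=.
    have Ja : 0 <= J%:R * alpha by rewrite mulr_ge0.
    rewrite normrM normrX normrN (ger0_norm m0) ger0_norm; last first.
      by rewrite negbin_ge0//; lra.
    apply: le_trans (H J); rewrite ler_wpM2l ?exprn_ge0//.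
    by apply: ler_negbin; lra.
  - exact: cvg_cst.
  - by apply: cvg_geometric; rewrite ger0_norm.
have L : mu * S n J + \sum_(l < n.+1) negbin (- alpha) l * S (n - l)%N J
    @[J --> \oo] --> mu * discrete_ml alpha mu n +
      \sum_(l < n.+1) negbin (- alpha) l * discrete_ml alpha mu (n - l).
  apply: cvgD; first by apply: cvgM; [exact: cvg_cst|].
  apply: cvg_big => [|l _]; first exact: add_continuous.
  apply: cvgM; [exact: cvg_cst|exact: SC].
have L' : mu * S n J + \sum_(l < n.+1) negbin (- alpha) l * S (n - l)%N J
    @[J --> \oo] --> negbin (1 - alpha) n - 0.
  under eq_fun do rewrite /S discrete_ml_partial_recursion.
  by apply: cvgB => //; exact: cvg_cst.
have := cvg_unique _ L L'; rewrite subr0 => <-//.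
rewrite big_ord_recl/= negbin0 mul1r subn0.
have -> : \sum_(l < n) - negbin (- alpha) l.+1 * discrete_ml alpha mu (n - l.+1) =
    - \sum_(l < n) negbin (- alpha) (bump 0 l) *
      discrete_ml alpha mu (n - bump 0 l).
  by rewrite -sumrN; apply: eq_bigr => l _; rewrite mulNr.
by ring.
Unshelve. all: by end_near. Qed.

Lemma discrete_ml_ge0 (R : realType) (alpha mu : R) (n : nat) :
  0 <= alpha <= 1 -> 0 <= mu < 1 -> 0 <= discrete_ml alpha mu n.
Proof.
move=> a01 m01; have /andP[a0 a1] := a01; have /andP[m0 m1] := m01.
elim/ltn_ind: n => n IHn.
have m1' : 0 < 1 + mu by lra.
rewrite -(pmulr_rge0 _ m1') discrete_ml_recursion// addr_ge0//.
  by rewrite negbin_ge0// subr_ge0.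
apply: sumr_ge0 => l _; rewrite mulr_ge0 ?oppr_ge0 ?negbin_le0//.
by apply: IHn; rewrite ltn_subrL (leq_ltn_trans _ (ltn_ord l)).
Qed.

Lemma discrete_ml_nonincreasing (R : realType) (alpha mu nu : R) (n : nat) :
  0 <= alpha <= 1 -> 0 <= mu -> mu <= nu -> nu < 1 ->
  discrete_ml alpha nu n <= discrete_ml alpha mu n.
Proof.
move=> a01 m0 mn n1; have /andP[a0 a1] := a01.
have m01 : 0 <= mu < 1 by rewrite m0 (le_lt_trans mn).
have n01 : 0 <= nu < 1 by rewrite n1 (le_trans m0).
elim/ltn_ind: n => n IHn.
have m1' : 0 < 1 + mu by lra.
rewrite -(ler_pM2l m1') (@le_trans _ _ ((1 + nu) * discrete_ml alpha nu n))//.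
  by rewrite ler_wpM2r ?discrete_ml_ge0// lerD2l.
rewrite !discrete_ml_recursion// lerD2l ler_sum// => l _.
rewrite ler_wpM2l ?oppr_ge0 ?negbin_le0//.
by apply: IHn; rewrite ltn_subrL (leq_ltn_trans _ (ltn_ord l)).
Qed.

(** * Gauss's product formula for the Gamma function *)

Lemma powR_derivable_oo_LRcontinuous (R : realType) (s N : R) : 0 < s -> 0 < N ->
  derivable_oo_LRcontinuous (fun t : R => t `^ s) 0 N.
Proof.
move=> s0 N0; split.
- move=> t; rewrite in_itv/= => /andP[t0 _].
  by apply: derivable_powR; rewrite in_itv/= t0.
- by rewrite powR0 ?gt_eqF//; exact: powR_cvg0.
- apply: cvg_at_left_filter.
  have : derivable (fun t : R => t `^ s) N 1.
    by apply: derivable_powR; rewrite in_itv/= N0.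
  by move=> /derivable1_diffP /differentiable_continuous; exact.
Qed.

Lemma within_continuous_powR (R : realType) (s N : R) : 0 <= s -> 0 < N ->
  {within `[0, N], continuous (fun t : R => t `^ s)}.
Proof.
rewrite le_eqVlt => /predU1P[<- N0|s0 N0].
  rewrite (_ : (fun t : R => t `^ 0) = cst 1); first by move=> x; exact: cvg_cst.
  by apply/funext => t; rewrite powRr0.
exact/derivable_oo_LRcontinuous_within/powR_derivable_oo_LRcontinuous.
Qed.

Lemma within_continuous_beta (R : realType) (s N : R) (k : nat) :
  0 <= s -> 0 < N ->
  {within `[0, N], continuous (fun t : R => t `^ s * (1 - t / N) ^+ k)}.
Proof.
move=> s0 N0 x; apply: cvgM; first exact: within_continuous_powR.
have : continuous (fun t : R => (1 - t / N) ^+ k).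
  move=> t; apply: (@continuous_comp _ _ _ (fun t : R => 1 - t / N)
    (fun u => u ^+ k)).
    by apply: cvgB; [exact: cvg_cst|apply: cvgMl].
  exact: exprn_continuous.
by move=> /continuous_subspaceT; apply.
Qed.

Lemma beta_integrable (R : realType) (s N : R) (k : nat) : 0 <= s -> 0 < N ->
  (@lebesgue_measure R).-integrable `[0, N]
    (EFin \o (fun t : R => t `^ s * (1 - t / N) ^+ k)).
Proof.
move=> s0 N0; apply: continuous_compact_integrable; first exact: segment_compact.
exact: within_continuous_beta.
Qed.

Lemma beta_derive (R : realType) (s N t : R) (k : nat) : 0 < t -> N != 0 ->
  is_derive t 1 (fun t : R => t `^ (s + 1) * (1 - t / N) ^+ k.+1)
    ((s + k.+2%:R) * (t `^ s * (1 - t / N) ^+ k.+1) -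
     k.+1%:R * (t `^ s * (1 - t / N) ^+ k)).
Proof.
move=> t0 N0.
have d1 := is_derive1_powR (s + 1) t0.
have d2 : is_derive t 1 (fun t : R => 1 - t / N) (- N^-1).
  by apply: is_derive_eq; rewrite /GRing.scale/=; ring.
have d4 := is_deriveM d1 (is_deriveX k.+1 d2).
rewrite (_ : (fun _ => _) = (fun t : R => t `^ (s + 1)) *
    (fun t : R => 1 - t / N) ^+ k.+1); last first.
  by apply/funext => u /=; rewrite mulrfctE exprfctE.
apply: (@is_derive_eq _ _ _ _ _ _ _ _ d4).
rewrite /GRing.scale/= exprfctE addrK.
rewrite powRD; last by rewrite (gt_eqF t0) implybT.
rewrite powRr1 ?(ltW t0)// exprS -[k.+2%:R]natr1 -natr1.
by field.
Qed.

(** The function t^(s+1) (1 - t/N)^(k+1) vanishes at 0 and N; its derivative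
    is a combination of the two integrands. *)
Lemma beta_recursion (R : realType) (s N : R) (k : nat) : 0 <= s -> 0 < N ->
  (s + k.+2%:R) *
    \int[lebesgue_measure]_(t in `[0, N]) (t `^ s * (1 - t / N) ^+ k.+1) =
  k.+1%:R * \int[lebesgue_measure]_(t in `[0, N]) (t `^ s * (1 - t / N) ^+ k).
Proof.
move=> s0 N0; apply/eqP; rewrite -subr_eq0; apply/eqP.
have s1 : 0 < s + 1 by rewrite ltr_wpDl.
pose f k t := t `^ s * (1 - t / N) ^+ k.
pose F t := t `^ (s + 1) * (1 - t / N) ^+ k.+1.
have intf j : lebesgue_measure.-integrable `[0, N] (EFin \o f j).
  exact: beta_integrable.
have intfZ j c : lebesgue_measure.-integrable `[0, N]
    (EFin \o (fun t => c * f j t)).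
  rewrite (_ : _ \o _ = fun t => (c%:E * (EFin \o f j) t)%E)//.
  exact: integrableZl.
rewrite -(@RintegralZl _ _ _ lebesgue_measure `[0, N] (f k.+1))//.
rewrite -(@RintegralZl _ _ _ lebesgue_measure `[0, N] (f k))//.
rewrite -(@RintegralB _ _ _ lebesgue_measure `[0, N])//.
rewrite /Rintegral (@continuous_FTC2 _ _ F)//=.
- by rewrite /F divff ?gt_eqF// subrr expr0n mulr0 powR0 ?gt_eqF// mul0r subrr.
- move=> x; apply: cvgB; (apply: cvgM; first exact: cvg_cst);
    exact: within_continuous_beta.
- have cF : {within `[0, N], continuous F}.
    by apply: within_continuous_beta => //; exact: ltW.
  have [_ F0 FN] := (continuous_within_itvP F N0).1 cF.
  split => //.
  move=> t; rewrite in_itv/= => /andP[t0 _].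
  apply: ex_derive; apply: beta_derive => //; exact: lt0r_neq0.
- move=> t; rewrite in_itv/= => /andP[t0 _].
  rewrite derive1E; apply: derive_val; apply: beta_derive => //; exact: lt0r_neq0.
Qed.

Lemma beta_integralE (R : realType) (s N : R) (k : nat) : 0 <= s -> 0 < N ->
  \int[lebesgue_measure]_(t in `[0, N]) (t `^ s * (1 - t / N) ^+ k) =
  N `^ (s + 1) / ((s + k.+1%:R) * negbin (s + 1) k).
Proof.
move=> s0 N0; have s1 : 0 < s + 1 by rewrite ltr_wpDl.
elim: k => [|k IHk].
  rewrite negbin0 mulr1 /Rintegral.
  pose F t := (s + 1)^-1 * t `^ (s + 1).
  rewrite (@continuous_FTC2 _ _ F)//=.
  - by rewrite /F powR0 ?gt_eqF// mulr0 subr0 mulrC.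
  - exact: within_continuous_beta.
  - have [dF F0 FN] := powR_derivable_oo_LRcontinuous _ _ _ s1 N0.
    split; last 2 first.
    + by apply: cvgM; first exact: cvg_cst.
    + by apply: cvgM; first exact: cvg_cst.
    by move=> t t0; apply: derivableM => //; exact: dF.
  - move=> t; rewrite in_itv/= => /andP[t0 _].
    rewrite derive1E /F; have d1 := is_derive1_powR (s + 1) t0.
    rewrite deriveZ//= expr0 mulr1.
    by rewrite derive_val addrK /GRing.scale/= mulrA mulVf ?mul1r// gt_eqF.
have sk : 0 < s + k.+2%:R by rewrite ltr_wpDl.
have sk1 : 0 < s + k.+1%:R by rewrite ltr_wpDl.
apply: (mulfI (lt0r_neq0 sk)); rewrite beta_recursion// IHk negbinS.
have := negbin_gt0 _ _ k s1; rewrite lt0r => /andP[b0 _].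
have -> : k%:R + (s + 1) = s + k.+1%:R by rewrite -natr1; ring.
have kE : k.+2%:R = 2 + k%:R :> R by rewrite -!natr1; ring.
have k0 : 0 <= k%:R :> R by [].
rewrite -[k.+1%:R]natr1 kE; field; rewrite b0; repeat (apply/andP; split => //).
all: by apply: lt0r_neq0; lra.
Qed.

(** Raise t <= c exp(t / c), with c = 2 (s + 1), to the power s. *)
Lemma powR_le_expR (R : realType) (s t : R) : 0 <= s -> 0 <= t ->
  t `^ s <= (2 * (s + 1)) `^ s * expR (t / 2).
Proof.
move=> s0 t0.
(* c >= 2 s makes the resulting exponent t s / c at most t / 2. *)
pose c := 2 * (s + 1).
have c0 : 0 < c by rewrite /c; lra.
have tc : t <= c * expR (t / c).
  rewrite mulrC -ler_pdivrMr//; apply: le_trans (expR_ge1Dx _).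
  by rewrite lerDr.
have : t `^ s <= (c * expR (t / c)) `^ s.
  by apply: ge0_ler_powR; rewrite ?nnegrE// mulr_ge0 ?expR_ge0 ?ltW.
move=> /le_trans; apply.
rewrite powRM ?expR_ge0 ?(ltW c0)// -expRM ler_wpM2l ?powR_ge0// ler_expR.
rewrite -mulrA ler_wpM2l// mulrC ler_pdivrMr// /c.
by lra.
Qed.

Lemma integrable_gamma (R : realType) (s : R) : 0 <= s ->
  (@lebesgue_measure R).-integrable `]0, +oo[
    (EFin \o (fun t : R => t `^ s * expR (- t))).
Proof.
move=> s0.
(* The factor 2 cancels the normalization 1/2 of the exponential density. *)
pose C := 2 * (2 * (s + 1)) `^ s.
have C0 : 0 <= C by rewrite mulr_ge0// powR_ge0.
have i1 : (@lebesgue_measure R).-integrable `]0, +oo[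
    (fun t => (C%:E * (EFin \o exponential_pdf (2^-1 : R)) t)%E).
  apply: integrableZl => //.
  by apply: integrableS (integrable_exponential_pdf _) => //; rewrite invr_gt0.
apply: le_integrable i1 => //.
  apply/measurable_EFinP; apply: measurable_funM.
    exact: measurable_funS (measurable_powR _).
  by apply: measurableT_comp => //; exact: measurable_funS (@measurableT _ _) _ _.
move=> t; rewrite /= in_itv/= andbT => t0.
have t0' := ltW t0.
rewrite lee_fin exponential_pdfE// !ger0_norm; last 2 first.
  by rewrite !mulr_ge0// ?expR_ge0// powR_ge0.
  by rewrite mulr_ge0 ?expR_ge0 ?powR_ge0.
rewrite (_ : C * _ = (2 * (s + 1)) `^ s * expR (- 2^-1 * t)); last first.
  by rewrite /C; field.
rewrite (_ : - 2^-1 * t = t / 2 - t); last by field.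
rewrite expRD mulrA ler_wpM2r ?expR_ge0//.
exact: powR_le_expR.
Qed.

Lemma bernoulli_inequality (R : realType) (y : R) (n : nat) : 0 <= y <= 1 ->
  1 - n%:R * y <= (1 - y) ^+ n.
Proof.
move=> /andP[y0 y1]; elim: n => [|n IHn]; first by rewrite mul0r subr0.
have h : (1 - y) * (1 - n%:R * y) <= (1 - y) * (1 - y) ^+ n.
  by rewrite ler_wpM2l// subr_ge0.
rewrite exprS; apply: le_trans h; rewrite -natr1.
have : 0 <= n%:R * (y * y) by rewrite !mulr_ge0.
by lra.
Qed.

(** The next two lemmas bound (1 - t/n)^n between exp(-t) (1 - t^2/n) and
    exp(-t), which replaces a convergence theorem for the integrals by an
    explicit rate. *)
Lemma compound_le_expR (R : realType) (t : R) (n : nat) : 0 <= t <= n.+1%:R ->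
  (1 - t / n.+1%:R) ^+ n.+1 <= expR (- t).
Proof.
move=> /andP[t0 tn]; have n0 : 0 < n.+1%:R :> R by [].
rewrite (_ : - t = n.+1%:R * (- (t / n.+1%:R))); last first.
  by field; rewrite lt0r_neq0.
rewrite expRM_natl lerXn2r ?nnegrE ?expR_ge0//; last exact: expR_ge1Dx.
by rewrite subr_ge0 ler_pdivrMr// mul1r.
Qed.

(** With x = t/n: 1 - x = (1 - x^2) / (1 + x) >= (1 - x^2) exp(-x), and
    Bernoulli's inequality bounds (1 - x^2)^n. *)
Lemma expR_le_compound (R : realType) (t : R) (n : nat) : 0 <= t <= n.+1%:R ->
  expR (- t) * (1 - t ^+ 2 / n.+1%:R) <= (1 - t / n.+1%:R) ^+ n.+1.
Proof.
move=> /andP[t0 tn]; have n0 : 0 < n.+1%:R :> R by [].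
pose x := t / n.+1%:R.
have x0 : 0 <= x by rewrite divr_ge0.
have x1 : x <= 1 by rewrite ler_pdivrMr// mul1r.
have x2 : 0 <= x ^+ 2 <= 1 by rewrite exprn_ge0//= expr_le1.
rewrite (_ : - t = n.+1%:R * (- x)); last first.
  by rewrite /x; field; rewrite lt0r_neq0.
rewrite (_ : t ^+ 2 / n.+1%:R = n.+1%:R * x ^+ 2); last first.
  by rewrite /x; field; rewrite lt0r_neq0.
rewrite expRM_natl.
apply: (@le_trans _ _ (expR (- x) ^+ n.+1 * (1 - x ^+ 2) ^+ n.+1)).
  by rewrite ler_wpM2l ?exprn_ge0 ?expR_ge0// bernoulli_inequality.
rewrite -exprMn lerXn2r ?nnegrE ?mulr_ge0 ?expR_ge0 ?subr_ge0//.
  by case/andP: x2.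
rewrite (_ : 1 - x ^+ 2 = (1 + x) * (1 - x)); last by ring.
rewrite mulrA ler_piMl ?subr_ge0//.
by rewrite expRN mulrC ler_pdivrMr ?expR_gt0// mul1r expR_ge1Dx.
Qed.

Lemma Gamma_addr1 (R : realType) (s : R) :
  Gamma (s + 1) =
  \int[lebesgue_measure]_(t in `]0, +oo[) (t `^ s * expR (- t)).
Proof. by rewrite /Gamma; apply: eq_Rintegral => t _; rewrite addrK. Qed.

(** Euler's approximation of Gamma (s + 1). *)
Definition euler_integral {R : realType} (s : R) (n : nat) : R :=
  \int[lebesgue_measure]_(t in `[0, n.+1%:R])
    (t `^ s * (1 - t / n.+1%:R) ^+ n.+1).

(** Extending the integrand by 0 lets Euler's integral be compared with Gamma
    on the common domain ]0, +oo[. *)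
Lemma euler_integral_patch (R : realType) (s : R) (n : nat) : 0 <= s ->
  let h := (fun t : R => t `^ s * (1 - t / n.+1%:R) ^+ n.+1) \_ `]0, n.+1%:R] in
  (@lebesgue_measure R).-integrable `]0, +oo[ (EFin \o h) /\
  euler_integral s n = \int[lebesgue_measure]_(t in `]0, +oo[) h t.
Proof.
move=> s0 h; have n0 : 0 < n.+1%:R :> R by [].
pose f := fun t : R => t `^ s * (1 - t / n.+1%:R) ^+ n.+1.
have fi : (@lebesgue_measure R).-integrable `]0, n.+1%:R] (EFin \o f).
  apply: integrableS (beta_integrable _ _ _ n.+1 s0 n0) => //.
  by apply: subset_itvr; rewrite bnd_simp.
split.
  have : (@lebesgue_measure R).-integrable setT (EFin \o h).
    by rewrite -restrict_EFin; apply: (integrable_mkcond _ _).1.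
  exact: integrableS.
rewrite -Rintegral_mkcondr setIidr; last by apply: subset_itvl.
by rewrite Rintegral_itv_obnd_cbnd.
Qed.

Lemma euler_integral_le_Gamma (R : realType) (s : R) (n : nat) : 0 <= s ->
  euler_integral s n <= Gamma (s + 1).
Proof.
move=> s0; have [ih ->] := euler_integral_patch _ s n s0.
rewrite Gamma_addr1; apply: le_Rintegral => //; first exact: integrable_gamma.
move=> t; rewrite /= in_itv/= andbT => t0; rewrite patchE.
case: ifPn => [|_]; last by rewrite mulr_ge0 ?powR_ge0 ?expR_ge0.
rewrite inE/= in_itv/= => /andP[_ tn].
by rewrite ler_wpM2l ?powR_ge0// compound_le_expR// ltW.
Qed.

(** The error exp(-t) t^2/n, integrated against t^s, is a value of Gamma. *)
Lemma Gamma_le_euler_integral (R : realType) (s : R) (n : nat) : 0 <= s ->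
  Gamma (s + 1) - n.+1%:R^-1 * Gamma (s + 2 + 1) <= euler_integral s n.
Proof.
move=> s0; have [ih ->] := euler_integral_patch _ s n s0.
have n0 : 0 < n.+1%:R :> R by [].
have s2 : 0 <= s + 2 by lra.
have i0 := integrable_gamma _ _ s0; have i2 := integrable_gamma _ _ s2.
have i2' : (@lebesgue_measure R).-integrable `]0, +oo[
    (EFin \o (fun t : R => n.+1%:R^-1 * (t `^ (s + 2) * expR (- t)))).
  pose c : R := n.+1%:R^-1; pose g2 (t : R) : R := t `^ (s + 2) * expR (- t).
  rewrite (_ : _ \o _ = fun t : R => (c%:E * (EFin \o g2) t)%E)//.
  exact: integrableZl.
rewrite !Gamma_addr1 -RintegralZl// -RintegralB//.
apply: le_Rintegral => //.
  pose g0 (t : R) : R := t `^ s * expR (- t).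
  pose g2 (t : R) : R := n.+1%:R^-1 * (t `^ (s + 2) * expR (- t)).
  rewrite (_ : _ \o _ = (EFin \o g0) \- (EFin \o g2))%E//.
  exact: integrableB.
move=> t; rewrite /= in_itv/= andbT => t0.
rewrite (_ : _ - _ = t `^ s * (expR (- t) * (1 - t ^+ 2 / n.+1%:R))); last first.
  rewrite powRD; last by rewrite (gt_eqF t0) implybT.
  by rewrite (powR_mulrn 2 (ltW t0)); ring.
rewrite patchE; case: ifPn => [|].
  rewrite inE/= in_itv/= => /andP[_ tn].
  by rewrite ler_wpM2l ?powR_ge0// expR_le_compound// ltW.
rewrite notin_setE/= in_itv/= t0/= => /negP; rewrite -ltNge => nt.
rewrite mulr_ge0_le0 ?powR_ge0// mulr_ge0_le0 ?expR_ge0// subr_le0.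
rewrite ler_pdivlMr// mul1r expr2 (le_trans (ltW nt))// ler_peMr ?(ltW t0)//.
by rewrite (le_trans _ (ltW nt))// ler1n.
Qed.

Lemma euler_integral_gt0 (R : realType) (s : R) (n : nat) : 0 <= s ->
  0 < euler_integral s n.
Proof.
move=> s0; have n0 : 0 < n.+1%:R :> R by [].
have s1 : 0 < s + 1 by rewrite ltr_wpDl.
rewrite /euler_integral beta_integralE// divr_gt0 ?powR_gt0//.
rewrite mulr_gt0 ?negbin_gt0//.
by rewrite ltr_wpDl.
Qed.

Lemma Gamma_addr1_gt0 (R : realType) (s : R) : 0 <= s -> 0 < Gamma (s + 1).
Proof.
move=> s0; apply: lt_le_trans (euler_integral_le_Gamma _ _ 0 s0).
exact: euler_integral_gt0.
Qed.

Lemma euler_integral_cvg (R : realType) (s : R) : 0 <= s ->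
  euler_integral s n @[n --> \oo] --> Gamma (s + 1).
Proof.
move=> s0.
apply: (@squeeze_cvgr _ _ _ _
  (fun n => Gamma (s + 1) - n.+1%:R^-1 * Gamma (s + 2 + 1))
  (cst (Gamma (s + 1)))).
- near=> n; apply/andP; split; first exact: Gamma_le_euler_integral.
  exact: euler_integral_le_Gamma.
- rewrite -[X in _ --> X]subr0 -[X in _ - X](mul0r (Gamma (s + 2 + 1))).
  apply: cvgB; first exact: cvg_cst.
  by apply: cvgM; [exact: cvg_harmonic|exact: cvg_cst].
- exact: cvg_cst.
Unshelve. all: by end_near. Qed.

(** The reciprocal of Gauss's approximation of Gamma (s + 1), with n + 1
    factors. *)
Definition gauss_seq {R : realType} (s : R) (n : nat) : R :=
  negbin (s + 1) n.+1 / n.+1%:R `^ s.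

Lemma gauss_seqE (R : realType) (s : R) (n : nat) : 0 <= s ->
  gauss_seq s n = ((1 + (s + 1) * n.+1%:R^-1) * euler_integral s n)^-1.
Proof.
move=> s0; have n0 : 0 < n.+1%:R :> R by [].
have s1 : 0 < s + 1 by rewrite ltr_wpDl.
have sn : 0 < s + n.+2%:R by rewrite ltr_wpDl.
have b0 := negbin_gt0 _ _ n.+1 s1.
have p0 : 0 < n.+1%:R `^ s by rewrite powR_gt0.
rewrite /gauss_seq /euler_integral beta_integralE//.
rewrite powRD; last by rewrite (gt_eqF n0) implybT.
rewrite (powRr1 (ltW n0)).
have -> : s + n.+2%:R = s + 1 + n.+1%:R :> R by rewrite -[n.+2%:R]natr1; ring.
have sn' : 0 < s + 1 + n.+1%:R by rewrite addr_gt0.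
by field; rewrite !lt0r_neq0//= [1 + _]addrC natr1.
Qed.

Lemma gauss_seq_cvg (R : realType) (s : R) : 0 <= s ->
  gauss_seq s n @[n --> \oo] --> (Gamma (s + 1))^-1.
Proof.
move=> s0; under eq_fun do rewrite gauss_seqE//.
apply: cvgV; first by rewrite lt0r_neq0// Gamma_addr1_gt0.
rewrite -[X in _ --> X]mul1r; apply: cvgM; last exact: euler_integral_cvg.
rewrite -[X in _ --> X]addr0 -(mulr0 (s + 1)).
apply: cvgD; first exact: cvg_cst.
by apply: cvgM; [exact: cvg_cst|exact: cvg_harmonic].
Qed.

(** The ratio of consecutive terms is (1 + s y) (1 - y)^s with y = 1/(n + 2),
    and 1 + x <= exp x applies to both factors. *)
Lemma gauss_seq_nonincreasing (R : realType) (s : R) : 0 <= s ->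
  nonincreasing_seq (gauss_seq s).
Proof.
move=> s0; apply/nonincreasing_seqP => n.
have n0 : 0 < n.+1%:R :> R by [].
have n20 : 0 < n.+2%:R :> R by [].
have s1 : 0 < s + 1 by rewrite ltr_wpDl.
pose y : R := n.+2%:R^-1.
have y0 : 0 < y by rewrite invr_gt0.
have nE : n.+1%:R = n.+2%:R * (1 - y) :> R.
  by rewrite /y mulrBr mulr1 divff ?lt0r_neq0// -[n.+2%:R]natr1 addrK.
have y1 : 0 <= 1 - y by rewrite -(pmulr_rge0 _ n20) -nE.
have p2 : 0 < n.+2%:R `^ s by rewrite powR_gt0.
have pE : n.+1%:R `^ s = n.+2%:R `^ s * (1 - y) `^ s.
  by rewrite {1}nE powRM ?(ltW n20).
rewrite /gauss_seq ler_pdivlMr ?powR_gt0// negbinS pE.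
rewrite [leLHS](_ : _ = negbin (s + 1) n.+1 * ((1 + s * y) * (1 - y) `^ s)).
  rewrite ler_piMr ?negbin_ge0 ?(ltW s1)//.
  have h1 : (1 - y) `^ s <= expR (- y * s).
    rewrite expRM ge0_ler_powR ?nnegrE ?expR_ge0//; exact: expR_ge1Dx.
  apply: (@le_trans _ _ (expR (s * y) * expR (- y * s))).
    rewrite ler_pM ?powR_ge0//; last exact: expR_ge1Dx.
    by rewrite addr_ge0// mulr_ge0// ltW.
  by rewrite -expRD mulNr mulrC subrr expR0.
have -> : n.+1%:R + (s + 1) = n.+2%:R + s :> R by rewrite -[n.+2%:R]natr1; ring.
by rewrite /y; field; rewrite !lt0r_neq0.
Qed.

(** * The Mittag-Leffler function on the negative half-line *)

(** With mu = x / N^alpha the j-th term of the scheme after N = n + 1 steps is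
    the j-th term of E_alpha (- x), except that Gamma is replaced by Gauss's
    approximation. *)
Lemma discrete_ml_term_gauss_seq (R : realType) (alpha x : R) (n j : nat) :
  discrete_ml_term alpha (x / n.+1%:R `^ alpha) n.+1 j =
  (- x) ^+ j * gauss_seq (j%:R * alpha) n.
Proof.
rewrite /discrete_ml_term /gauss_seq mulrC (mulrC j%:R alpha) powRrM.
rewrite powR_mulrn ?powR_ge0//.
by rewrite -mulNr exprMn exprVn; ring.
Qed.

Lemma near_divr_powR_lt1 (R : realType) (alpha x : R) : 0 < alpha -> 0 <= x ->
  \forall n \near \oo, 0 <= x / n.+1%:R `^ alpha < 1.
Proof.
move=> a0 x0.
(* b^alpha = x + 1 exceeds x. *)
pose b := (x + 1) `^ alpha^-1.
have x1 : 0 < x + 1 by rewrite ltr_wpDl.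
have b0 : 0 < b by rewrite powR_gt0.
near=> n.
have n0 : 0 < n.+1%:R :> R by [].
rewrite divr_ge0 ?powR_ge0//= ltr_pdivrMr ?powR_gt0// mul1r.
apply: (@lt_le_trans _ _ (x + 1)); first by rewrite ltrDl.
have -> : x + 1 = b `^ alpha by rewrite -powRrM mulVf ?lt0r_neq0// powRr1// ltW.
apply: ge0_ler_powR; rewrite ?nnegrE ?(ltW a0) ?(ltW b0)//.
apply: (@le_trans _ _ n%:R); last by rewrite ler_nat.
by near: n; exact: nbhs_infty_ger.
Unshelve. all: by end_near. Qed.

(** The domination comes from one fixed index n0: gauss_seq decreases, so all
    later terms are bounded by those of index n0, which are dominated by a
    geometric series once x / (n0 + 1)^alpha < 1. *)
Lemma mittag_leffler_cvg (R : realType) (alpha x : R) :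
  0 < alpha <= 1 -> 0 <= x ->
  discrete_ml alpha (x / n.+1%:R `^ alpha) n.+1 @[n --> \oo] -->
    mittag_leffler alpha (- x).
Proof.
move=> /andP[a0 a1] x0; have [n0 _ hn0] := near_divr_powR_lt1 _ _ _ a0 x0.
have a01 : 0 <= alpha <= 1 by rewrite a1 ltW.
have [M [q [M0 q0 q1 HM]]] :=
  negbin_geometric _ _ _ n0.+1 a01 (hn0 n0 (leqnn _)).
apply: (@tannery _ _ _ M q); first by rewrite q0.
- exists n0 => // n /= n0n j.
  rewrite discrete_ml_term_gauss_seq; apply: le_trans (HM j).
  have ja : 0 <= j%:R * alpha by rewrite mulr_ge0// ltW.
  have gn : 0 <= gauss_seq (j%:R * alpha) n.
    by rewrite /gauss_seq divr_ge0 ?powR_ge0// negbin_ge0// addr_ge0.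
  rewrite normrM normrX normrN !ger0_norm//.
  have := discrete_ml_term_gauss_seq _ alpha (- x) n0 j.
  rewrite /discrete_ml_term opprK mulNr opprK => ->.
  by rewrite ler_wpM2l ?exprn_ge0// gauss_seq_nonincreasing.
- move=> j; under eq_fun do rewrite discrete_ml_term_gauss_seq.
  apply: cvgM; first exact: cvg_cst.
  by apply: gauss_seq_cvg; rewrite mulr_ge0// ltW.
Qed.

Lemma mittag_leffler_ge0 (R : realType) (alpha x : R) :
  0 < alpha <= 1 -> 0 <= x -> 0 <= mittag_leffler alpha (- x).
Proof.
move=> a01 x0; have h := mittag_leffler_cvg _ _ _ a01 x0.
have /andP[a0 a1] := a01.
rewrite -(cvg_lim _ h)//; apply: limr_ge.
  by apply/cvg_ex; exists (mittag_leffler alpha (- x)).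
apply: filterS (near_divr_powR_lt1 _ _ _ a0 x0) => n mu01.
by apply: discrete_ml_ge0 => //; rewrite a1 ltW.
Qed.

Lemma mittag_leffler_nonincreasing (R : realType) (alpha x y : R) :
  0 < alpha <= 1 -> 0 <= x -> x <= y ->
  mittag_leffler alpha (- y) <= mittag_leffler alpha (- x).
Proof.
move=> a01 x0 xy; have y0 := le_trans x0 xy.
have hx := mittag_leffler_cvg _ _ _ a01 x0.
have hy := mittag_leffler_cvg _ _ _ a01 y0.
have /andP[a0 a1] := a01.
apply: (ler_cvg_to hy hx).
apply: filterS2 (near_divr_powR_lt1 _ _ _ a0 x0)
  (near_divr_powR_lt1 _ _ _ a0 y0) => n.
move=> /andP[mx0 mx1] /andP[my0 my1].
apply: discrete_ml_nonincreasing => //; first by rewrite a1 ltW.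
by rewrite ler_wpM2r// invr_ge0 powR_ge0.
Qed.

(** * Increments and everywhere existing derivatives *)

(** The supremum c of the points up to which H <= H a belongs to that set by the
    condition from the left, and can only be b by the one from the right.  The
    condition from the left is only semicontinuity: it allows H to jump down,
    as w m does at a jump of w. *)
Lemma le_of_local_nonincreasing (R : realType) (H : R -> R) (a b : R) : a <= b ->
  (forall x, a <= x < b -> \forall y \near x^'+, H y <= H x) ->
  (forall x, a < x <= b -> forall e, 0 < e ->
    \forall y \near x^'-, H x <= H y + e) ->
  H b <= H a.
Proof.
move=> ab Hr Hl.
pose S := [set x | a <= x <= b /\ forall z, a <= z <= x -> H z <= H a].
have Sa : S a.
  split; first by rewrite lexx.
  by move=> z az; have /eqP <- : a == z by rewrite eq_le.
have Sub : has_ubound S by exists b => x [/andP[]].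
have Ssup : has_sup S by split => //; exists a.
set c := sup S.
have ac : a <= c by apply: ub_le_sup.
have cb : c <= b by apply: ge_sup; [exists a|move=> x [/andP[]]].
have Slt y : a <= y -> y < c -> H y <= H a.
  move=> ay yc; have cy : 0 < c - y by rewrite subr_gt0.
  have [s [sab Hs] ys] := sup_adherent cy Ssup.
  by apply: Hs; rewrite ay/=; move: ys; rewrite -/c subKr => /ltW.
have Hc : H c <= H a.
  move: ac; rewrite le_eqVlt => /predU1P[<-//|ac].
  apply/ler_addgt0Pr => e e0.
  have acb : a < c <= b by rewrite ac cb.
  near c^'- => y.
  apply: (@le_trans _ _ (H y + e)); first by near: y; exact: Hl.
  by rewrite lerD2r; apply: Slt; near: y; [exact: nbhs_left_ge|exact: nbhs_left_lt].
move: cb; rewrite le_eqVlt => /predU1P[<-//|cb].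
have acb : a <= c < b by rewrite ac cb.
have /nbhs_ballP[d /= d0 hd] := Hr _ acb.
pose y := Num.min (c + d / 2) b.
have cy : c < y by rewrite lt_min cb andbT ltrDl divr_gt0.
have Sy : S y.
  split; first by rewrite (le_trans ac (ltW cy)) /y ge_min lexx orbT.
  move=> z /andP[az zy].
  have [zc|cz] := ltP z c; first exact: Slt.
  move: cz; rewrite le_eqVlt => /predU1P[<-//|cz].
  apply: le_trans Hc; apply: hd => //.
  rewrite /ball/= ltr_distlC; apply/andP; split.
    by rewrite (lt_trans _ cz)// gtrBl.
  apply: (le_lt_trans zy); apply: (@le_lt_trans _ _ (c + d / 2)).
    by rewrite /y ge_min lexx.
  by rewrite ltrD2l ltr_pdivrMr// ltr_pMr// ltr1n.
by have := ub_le_sup Sub Sy; rewrite leNgt cy.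
Unshelve. all: by end_near. Qed.

Lemma negligible_open_cover (R : realType) (Z : set R) (e : R) :
  (@lebesgue_measure R).-negligible Z -> 0 < e ->
  exists U : set R, [/\ open U, Z `<=` U & (lebesgue_measure U < e%:E)%E].
Proof.
move=> [A [mA A0 ZA]] e0.
have Aoo : (lebesgue_measure A < +oo)%E by rewrite [ltLHS]A0.
have [U [oU AU hU]] := lebesgue_regularity_outer mA Aoo e0.
exists U; split => //; first exact: subset_trans AU.
have mU : measurable U by exact: open_measurable.
have -> : lebesgue_measure U = lebesgue_measure (U `\` A).
  rewrite -[in LHS](setDUK AU) measureU//; last 2 first.
  - exact: measurableD.
  - by rewrite setIC setDKI.
  by rewrite [X in (X + _)%E]A0 add0e.
exact: hU.
Qed.

(** Sum the measures of ]-oo, x] inside open sets V_n that contain Z and have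
    measure at most 2^(-n-1): at a point of Z the first k of these sets each
    contribute the slope 1. *)
Lemma infinite_derivative_on_negligible (R : realType) (Z : set R) :
  (@lebesgue_measure R).-negligible Z ->
  exists P : R -> R, [/\ forall x, 0 <= P x <= 1,
    {homo P : x y / x <= y} &
    forall x K, Z x -> \forall y \near x^'+, K * (y - x) <= P y - P x].
Proof.
move=> Z0; pose e n : R := 2^-1 * 2^-1 ^+ n.
have e0 n : 0 < e n by rewrite mulr_gt0 ?exprn_gt0 ?invr_gt0.
have /choice[V hV] : forall n, exists U : set R,
    [/\ open U, Z `<=` U & (lebesgue_measure U < (e n)%:E)%E].
  by move=> n; exact: negligible_open_cover.
have oV n : open (V n) by case: (hV n).
have ZV n : Z `<=` V n by case: (hV n).
have mV n : measurable (V n) by exact: open_measurable.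
have mI x : measurable `]-oo, x : R]%classic by exact: measurable_itv.
have mVI n x : measurable (V n `&` `]-oo, x]%classic).
  exact: measurableI (mV n) (mI x).
pose p n x : R := fine (lebesgue_measure (V n `&` `]-oo, x]%classic)).
have pfin n x : lebesgue_measure (V n `&` `]-oo, x]%classic) \is a fin_num.
  rewrite ge0_fin_numE//; have [_ _ h] := hV n.
  apply: le_lt_trans (lt_trans h (ltry _)).
  by apply: le_measure; rewrite ?inE//; [exact: mVI|exact: mV].
have p0 n x : 0 <= p n x by rewrite fine_ge0.
have pe n x : p n x <= e n.
  rewrite -lee_fin fineK//; have [_ _ h] := hV n.
  apply: le_trans (ltW h).
  by apply: le_measure; rewrite ?inE//; [exact: mVI|exact: mV].
have pD n x y : x <= y -> (p n y)%:E =
    ((p n x)%:E + lebesgue_measure (V n `&` `]x, y]%classic))%E.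
  move=> xy; rewrite !fineK// -measureU.
  - congr (lebesgue_measure _); rewrite -setIUr; congr (_ `&` _).
    by rewrite -itv_bndbnd_setU// bnd_simp.
  - exact: mVI.
  - by apply: measurableI => //; exact: mV.
  - rewrite -subset0 => z [[_ /=]]; rewrite !in_itv/= => zx [_ /andP[]].
    by rewrite ltNge zx.
have pm n x y : x <= y -> p n x <= p n y.
  by move=> xy; rewrite -lee_fin (pD n x y xy) leeDl.
have pV n x y : x <= y -> `]x, y]%classic `<=` V n -> p n y - p n x = y - x.
  move=> xy sub; apply/eqP; rewrite subr_eq; apply/eqP; apply: EFin_inj.
  rewrite (pD n x y xy) (setIidr sub) lebesgue_measure_itv/= lte_fin.
  case: ltgtP xy => // [xy _|-> _]; first by rewrite -EFinB -EFinD addrC.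
  by rewrite adde0 subrr add0r.
have pM x n : `|p n x| <= 2^-1 * 2^-1 ^+ n by rewrite ger0_norm// pe.
have half01 : 0 <= (2^-1 : R) < 1 by apply/andP; split; lra.
have pcvg x : cvgn (series (fun n => p n x)).
  exact: (geometric_dominated_cvg _ _ _ _ half01 (pM x)).
pose P x := limn (series (fun n => p n x)).
have PB x y : P y - P x = limn (series (fun n => p n y - p n x)).
  by rewrite /P -lim_seriesB.
exists P; split.
- move=> x; apply/andP; split.
    apply: limr_ge => //; apply: nearW => n; exact: sumr_ge0.
  have := geometric_dominated_lim_tail _ _ _ _ 0%N half01 (pM x).
  rewrite /series/= big_geq// subr0 expr0 mulr1 => h.
  apply: le_trans (le_trans (ler_norm _) h) _.
  by rewrite ler_pdivrMr; lra.
- by move=> x y xy; apply: lim_series_le => // n; exact: pm.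
- move=> x K Zx.
  pose k := Num.truncn `|K|.
  have Kk : K <= k.+1%:R.
    by rewrite (le_trans (ler_norm _))// ltW// truncnS_gt.
  have near_sub j : \forall y \near x^'+,
      forall n, (n < j)%N -> `]x, y]%classic `<=` V n.
    elim: j => [|j IHj]; first exact: nearW.
    have /nbhs_ballP[d /= d0 hd] : nbhs x (V j).
      by apply: open_nbhs_nbhs; split; [exact: oV|exact: ZV].
    near=> y => n; rewrite ltnS leq_eqVlt => /predU1P[->|nj].
      move=> z /=; rewrite in_itv/= => /andP[xz zy]; apply: hd.
      rewrite /ball/= ltr_distlC (lt_trans _ xz) ?gtrBl//=.
      by apply: le_lt_trans zy _; near: y; apply: nbhs_right_lt; rewrite ltrDl.
    by move: n nj; near: y.
  near=> y.
  have xy : x <= y by near: y; exact: nbhs_right_ge.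
  have sub : forall n, (n < k.+1)%N -> `]x, y]%classic `<=` V n.
    by near: y; exact: near_sub.
  apply: (@le_trans _ _ (k.+1%:R * (y - x))); first by rewrite ler_wpM2r// subr_ge0.
  rewrite PB.
  apply: (@le_trans _ _ (series (fun n => p n y - p n x) k.+1)).
    rewrite /series/= big_mkord (eq_bigr (fun=> y - x)).
      by rewrite sumr_const card_ord mulr_natl.
    by move=> i _; apply: pV => //; exact: sub.
  apply: nondecreasing_cvgn_le.
    apply/nondecreasing_seqP => n; rewrite /series/= big_nat_recr//= lerDl subr_ge0.
    exact: pm.
  by apply: is_cvg_seriesB.
Unshelve. all: by end_near. Qed.

Lemma derivable_right_approx (R : realType) (f : R -> R) (x e : R) :
  derivable f x 1 -> 0 < e ->
  \forall y \near x^'+, `|f y - f x - derive1 f x * (y - x)| <= e * (y - x).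
Proof.
move=> df e0.
have h : h^-1 *: (f (h + x) - f x) @[h --> 0^'] --> derive1 f x.
  have c : cvg (h^-1 *: (f (h + x) - f x) @[h --> 0^']).
    rewrite (_ : (fun h => _) = (fun h => h^-1 *: (f (h *: 1 + x) - f x))) //.
    by apply/funext => k; rewrite /GRing.scale/= mulr1.
  exact: c.
have H0 : \forall k \near 0^',
    `|derive1 f x - k^-1 *: (f (k + x) - f x)| <= e.
  by move: e e0; apply/cvgrPdist_le.
have /nbhs_ballP[d /= d0 hd] := H0.
near=> y.
have xy : x < y by near: y; exact: nbhs_right_gt.
have yx0 : 0 < y - x by rewrite subr_gt0.
have := hd (y - x); rewrite /ball/= sub0r normrN (gtr0_norm yx0).
move=> /(_ _ (lt0r_neq0 yx0)) H.
have {}H := H (_ : y - x < d).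
have {}H : `|derive1 f x - (y - x)^-1 *: (f (y - x + x) - f x)| <= e.
  by apply: H; near: y; exact: nbhs_right_ltDr.
rewrite subrK /GRing.scale/= in H.
rewrite (_ : f y - _ - _ =
    - (derive1 f x - (y - x)^-1 * (f y - f x)) * (y - x)); last first.
  by field; rewrite lt0r_neq0.
by rewrite normrM normrN (gtr0_norm yx0) ler_pM2r.
Unshelve. all: by end_near. Qed.

Lemma Rintegral_itv_ge (R : realType) (f : R -> R) (x y k : R) (c : bool) :
  x <= y -> (@lebesgue_measure R).-integrable
    [set` Interval (BRight x) (BSide c y)] (EFin \o f) ->
  (forall t, t \in Interval (BRight x) (BSide c y) -> k <= f t) ->
  k * (y - x) <=
    \int[lebesgue_measure]_(t in [set` Interval (BRight x) (BSide c y)]) f t.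
Proof.
move=> xy fi kf.
have icc : (@lebesgue_measure R).-integrable `[x, y] (EFin \o cst k).
  apply: continuous_compact_integrable; first exact: segment_compact.
  by move=> z; exact: cvg_cst.
have -> : k * (y - x) =
    \int[lebesgue_measure]_(t in [set` Interval (BRight x) (BSide c y)]) k.
  have muI : fine (lebesgue_measure
      [set` Interval (BRight x) (BSide c y)]) = y - x.
    rewrite lebesgue_measure_itv/= lte_fin; case: ltgtP xy => // -> _.
    by rewrite subrr.
  by rewrite Rintegral_cst// [X in _ = _ * X]muI.
apply: le_Rintegral => //.
apply: integrableS icc => // z /=; rewrite !in_itv/= => /andP[xz zy].
by rewrite (ltW xz)/=; case: c zy {fi kf} => // /ltW.
Qed.

(** Let G be the indefinite integral of phi.  Off a negligible set Z the
    derivative of G is phi, and there F - G - eta x has a nonpositive right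
    upper derivate.  On Z the difference quotients of G are only known to be at
    least - N; subtracting eta P, where P has an infinite derivative on Z,
    compensates for this.  Hence F - G - eta P - eta x does not increase, and
    eta is arbitrary. *)
Lemma upper_derivate_le_integral (R : realType) (F phi : R -> R) (a b N : R) :
  a <= b -> (@lebesgue_measure R).-integrable setT (EFin \o phi) ->
  0 <= N -> (forall x, - N <= phi x) ->
  (forall x, a <= x < b -> forall e, 0 < e ->
    \forall y \near x^'+, F y - F x <= (phi x + e) * (y - x)) ->
  (forall x, a < x <= b -> forall e, 0 < e ->
    \forall y \near x^'-, F x <= F y + e) ->
  F b - F a <= \int[lebesgue_measure]_(t in `]a, b]) phi t.
Proof.
move=> ab iphi N0 phiN Fr Fl.
pose G x := \int[lebesgue_measure]_(t in `]-oo, x]) phi t.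
have iphiS (A : set R) : measurable A ->
    (@lebesgue_measure R).-integrable A (EFin \o phi).
  by move=> mA; apply: integrableS iphi.
have GB x y : x <= y -> G y - G x = \int[lebesgue_measure]_(t in `]x, y]) phi t.
  move=> xy; rewrite /G Rintegral_itvB ?bnd_simp//.
  exact: iphiS.
have GN x y : x <= y -> - N * (y - x) <= G y - G x.
  by move=> xy; rewrite GB//; apply: Rintegral_itv_ge => //; exact: iphiS.
have aeG : {ae lebesgue_measure, forall x, derivable G x 1 /\ derive1 G x = phi x}.
  apply: FTC1Ny; first by move=> y; exact: iphiS.
  by apply: open_integrable_locally => //; exact: openT.
have [P [P01 Pm PZ]] := infinite_derivative_on_negligible _ _ aeG.
rewrite -GB//; apply/ler_addgt0Pr => e e0.
(* P increases by at most 1 and the identity by b - a. *)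
pose eta := e / (1 + (b - a)).
have ba0 : 0 <= b - a by rewrite subr_ge0.
have eta0 : 0 < eta by rewrite divr_gt0//; lra.
pose H x := F x - G x - eta * P x - eta * x.
suff : H b <= H a.
  have eE : eta * 1 + eta * (b - a) = e by rewrite /eta; field; rewrite lt0r_neq0//; lra.
  have Pba : eta * (P b - P a) <= eta * 1.
    rewrite ler_pM2l//; have := P01 a; have := P01 b; lra.
  by rewrite /H; lra.
apply: le_of_local_nonincreasing => //.
- move=> x xab.
  have eta2 : 0 < eta / 2 by lra.
  have Frx := Fr x xab _ eta2.
  have [[dG GE]|nG] := pselect (derivable G x 1 /\ derive1 G x = phi x).
    have Gx := derivable_right_approx _ _ _ _ dG eta2.
    near=> y.
    have xy : x <= y by near: y; exact: nbhs_right_ge.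
    have h1 : F y - F x <= (phi x + eta / 2) * (y - x) by near: y.
    have h2 : `|G y - G x - derive1 G x * (y - x)| <= eta / 2 * (y - x) by near: y.
    have h3 := Pm _ _ xy.
    have h4 : 0 <= eta * (P y - P x) by apply: mulr_ge0; [exact: ltW|rewrite subr_ge0].
    move: h2; rewrite GE ler_norml => /andP[h2 _].
    rewrite /H; lra.
  (* eta P then grows at the rate N + phi x: phi x pays for F, N for - G. *)
  have PZx := PZ x ((N + phi x) / eta) nG.
  near=> y.
  have xy : x <= y by near: y; exact: nbhs_right_ge.
  have h1 : F y - F x <= (phi x + eta / 2) * (y - x) by near: y.
  have h2 : (N + phi x) / eta * (y - x) <= P y - P x by near: y.
  have h3 := GN _ _ xy.
  have h4 : 0 <= eta * (y - x) by apply: mulr_ge0; [exact: ltW|rewrite subr_ge0].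
  have {}h2 : (N + phi x) * (y - x) <= eta * (P y - P x).
    by rewrite -ler_pdivrMl//; apply: le_trans h2; rewrite mulrA (mulrC eta^-1).
  rewrite /H; lra.
- move=> x xab d d0.
  have d2 : 0 < d / 2 by lra.
  have Flx := Fl x xab _ d2.
  have N1 : 0 < N + 1 by lra.
  have dN : 0 < d / 2 / (N + 1) by rewrite divr_gt0.
  near=> y.
  have yx : y <= x by near: y; exact: nbhs_left_le.
  have h1 : F x <= F y + d / 2 by near: y.
  have h2 := GN _ _ yx.
  have h3 := Pm _ _ yx.
  have h4 : 0 <= eta * (P x - P y) by apply: mulr_ge0; [exact: ltW|rewrite subr_ge0].
  have h5 : x - y < d / 2 / (N + 1) by near: y; exact: nbhs_left_ltBl.
  have h6 : 0 <= eta * (x - y) by apply: mulr_ge0; [exact: ltW|rewrite subr_ge0].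
  have h7 : N * (x - y) <= d / 2.
    apply: (@le_trans _ _ ((N + 1) * (x - y))).
      by rewrite ler_wpM2r ?subr_ge0// lerDl.
    by rewrite mulrC -ler_pdivlMr// ltW.
  rewrite /H; lra.
Unshelve. all: by end_near. Qed.

Lemma derivable1_continuous (R : realType) (f : R -> R) (x : R) :
  derivable f x 1 -> {for x, continuous f}.
Proof. by move=> /derivable1_diffP /differentiable_continuous; exact. Qed.

(** The derivative is the pointwise limit of the difference quotients with
    steps 1/(n + 1). *)
Lemma derive1_measurable (R : realType) (f : R -> R) (a b : R) :
  (forall x, x \in `]a, b[ -> derivable f x 1) ->
  measurable_fun `]a, b[ (derive1 f).
Proof.
move=> df.
pose g := f \_ `]a, b[.
have mf : measurable_fun `]a, b[ f.
  apply: open_continuous_measurable_fun; first exact: interval_open.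
  by move=> x; rewrite inE/= => xab; apply: derivable1_continuous; exact: df.
have mg : measurable_fun setT g by apply/(measurable_restrictT _ _).1.
(* g, not f, so that no value outside ]a, b[ is used. *)
pose h n x := n.+1%:R * (g (x + n.+1%:R^-1) - g x).
apply: (@measurable_fun_cvg _ _ _ _ h).
  move=> n; apply: measurable_funTS; apply: measurable_funM => //.
  apply: measurable_funB => //.
  by apply: (measurableT_comp mg); exact: measurable_funD.
move=> x xab; have xab' : x \in `]a, b[ := xab.
apply/cvgrPdist_le => e e0.
have := derivable_right_approx _ _ _ _ (df _ xab') e0.
move=> /nbhs_ballP[d /= d0 hd].
have xb : 0 < b - x by move: xab; rewrite /= in_itv/= subr_gt0 => /andP[].
have d1 : 0 < Num.min d (b - x) by rewrite lt_min d0.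
near=> n.
have n0 : 0 < n.+1%:R^-1 :> R by rewrite invr_gt0.
have : n.+1%:R^-1 < Num.min d (b - x).
  near: n.
  by apply: (cvgr_lt (0 : R)) => //; exact: cvg_harmonic.
rewrite lt_min => /andP[nd nb].
have xab2 : x + n.+1%:R^-1 \in `]a, b[.
  move: xab; rewrite /= !in_itv/= => /andP[ax _]; apply/andP; split.
    by rewrite (lt_trans ax)// ltrDl.
  by rewrite addrC -ltrBrDr.
have := hd (x + n.+1%:R^-1); rewrite /ball/= opprD addNKr normrN gtr0_norm//.
move=> /(_ nd); rewrite ltrDl => /(_ n0).
rewrite [x + _ - x]addrAC subrr add0r => H.
rewrite /h /g !patchE !mem_set//.
rewrite (_ : _ - _ = - (f (x + n.+1%:R^-1) - f x - derive1 f x / n.+1%:R) * n.+1%:R).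
  by rewrite normrM normrN (ger0_norm (ler0n _ _)) -ler_pdivlMr.
by field; rewrite addrC natr1 pnatr_eq0.
Unshelve. all: by end_near. Qed.

(** At least one of the integrals of the positive and negative parts is
    infinite, so the extended integral is infinite and its finite part is 0. *)
Lemma Rintegral_not_integrable d (T : measurableType d) (R : realType)
    (mu : {measure set T -> \bar R}) (D : set T) (f : T -> R) :
  measurable D -> measurable_fun D f -> ~ mu.-integrable D (EFin \o f) ->
  \int[mu]_(x in D) f x = 0.
Proof.
move=> mD mf nif.
have mEf : measurable_fun D (EFin \o f) by exact/measurable_EFinP.
set p := (\int[mu]_(x in D) (EFin \o f)^\+ x)%E.
set n := (\int[mu]_(x in D) (EFin \o f)^\- x)%E.
have p0 : (0 <= p)%E by apply: integral_ge0.
have n0 : (0 <= n)%E by apply: integral_ge0.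
have pn : (p + n = +oo)%E.
  apply/eqP; rewrite -leye_eq leNgt; apply/negP => pn.
  apply: nif; apply/integrableP; split => //.
  rewrite (eq_integral (fun x => (EFin \o f)^\+ x + (EFin \o f)^\- x)%E).
    by rewrite ge0_integralD//; [exact: measurable_funepos|exact: measurable_funeneg].
  by move=> x _; rewrite -/((abse \o (EFin \o f)) x) fune_abse.
rewrite /Rintegral integralE -/p -/n.
by move: p n p0 n0 pn => [p| |] [n| |].
Qed.

(** The substitute for integration by parts.  The integrand f = w m' is
    truncated from below at - N, as [upper_derivate_le_integral] requires a
    lower bound; the truncation is removed by dominated convergence. *)
Lemma weighted_derive_integral_ge0 (R : realType) (m w : R -> R) (tau : R) :
  0 < tau ->
  (forall x, x \in `]0, tau[ -> derivable m x 1) ->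
  (forall x, x \in `]0, tau[ -> m x <= 0) ->
  m y @[y --> tau^'-] --> 0 ->
  (forall x, 0 <= w x) -> {homo w : x y / x <= y} ->
  0 <= \int[lebesgue_measure]_(x in `]0, tau[) (w x * derive1 m x).
Proof.
move=> tau0 dm m0 mtau w0 wm.
pose f x := w x * derive1 m x.
have mf : measurable_fun `]0, tau[ f.
  apply: measurable_funM; last exact: derive1_measurable.
  exact: nondecreasing_measurable.
have [iff|nif] := pselect ((@lebesgue_measure R).-integrable `]0, tau[ (EFin \o f));
  last by rewrite Rintegral_not_integrable.
pose fN (N : nat) x := Num.max (f x) (- N%:R).
have mfN N : measurable_fun `]0, tau[ (fN N).
  exact: measurable_maxr.
have fN_le N x : `|fN N x| <= `|f x|.
  rewrite /fN; have N0 : 0 <= N%:R :> R by [].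
  have [h|//] := leP (f x) (- N%:R).
  by rewrite normrN ger0_norm// ler_normr lerNr h orbT.
have ifN N : (@lebesgue_measure R).-integrable `]0, tau[ (EFin \o fN N).
  apply: le_integrable iff => //; first by apply/measurable_EFinP; exact: mfN.
  by move=> x _ /=; rewrite lee_fin.
have F_le N a b : 0 < a -> a <= b -> b < tau ->
    w b * m b - w a * m a <= \int[lebesgue_measure]_(x in `]a, b]) fN N x.
  move=> a0 ab bt.
  have sub x : a <= x <= b -> x \in `]0, tau[.
    move=> /andP[ax xb]; rewrite in_itv/=.
    by rewrite (lt_le_trans a0 ax) (le_lt_trans xb bt).
  pose phi := fN N \_ `]0, tau[.
  have -> : \int[lebesgue_measure]_(x in `]a, b]) fN N x =
      \int[lebesgue_measure]_(x in `]a, b]) phi x.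
    apply: eq_Rintegral => x; rewrite inE/= in_itv/= => /andP[ax xb].
    by rewrite /phi patchE mem_set//; apply: sub; rewrite xb ltW.
  apply: (@upper_derivate_le_integral _ (fun x => w x * m x) phi _ _ N%:R) => //.
  - by rewrite /phi -restrict_EFin; apply: (integrable_mkcond _ _).1.
  - move=> x; rewrite /phi patchE; case: ifPn => _; last by rewrite oppr_le0.
    by rewrite /fN le_max lexx orbT.
  - move=> x /andP[ax xb] e e0.
    have x0t : x \in `]0, tau[ by apply: sub; rewrite ax ltW.
    have w1 : 0 < w x + 1 by rewrite ltr_wpDl.
    have e1 : 0 < e / (w x + 1) by rewrite divr_gt0.
    have hm := derivable_right_approx _ _ _ _ (dm _ x0t) e1.
    near=> y.
    have xy : x <= y by near: y; exact: nbhs_right_ge.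
    have yb : y <= b by near: y; exact: nbhs_right_le.
    have y0t : y \in `]0, tau[ by apply: sub; rewrite yb (le_trans ax).
    have : `|m y - m x - derive1 m x * (y - x)| <= e / (w x + 1) * (y - x).
      by near: y.
    rewrite ler_norml => /andP[_ H].
    have phiE : f x <= phi x.
      by rewrite /phi patchE mem_set//= /fN le_max lexx.
    (* Here the sign of m and the monotonicity of w enter. *)
    have h1 : w y * m y <= w x * m y.
      by rewrite ler_wnM2r// ?m0// wm.
    have h2 : w x * (m y - m x - derive1 m x * (y - x)) <= e * (y - x).
      apply: (@le_trans _ _ (w x * (e / (w x + 1) * (y - x)))).
        by rewrite ler_wpM2l.
      rewrite mulrA ler_wpM2r ?subr_ge0// mulrCA ler_piMr ?(ltW e0)//.
      by rewrite ler_pdivrMr// mul1r lerDl.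
    have h3 : f x * (y - x) <= phi x * (y - x) by rewrite ler_wpM2r// subr_ge0.
    by rewrite /f in h3; lra.
  - move=> x /andP[ax xb] e e0.
    have x0t : x \in `]0, tau[ by apply: sub; rewrite xb ltW.
    have w1 : 0 < w x + 1 by rewrite ltr_wpDl.
    have e1 : 0 < e / (w x + 1) by rewrite divr_gt0.
    have cm : m y @[y --> x^'-] --> m x.
      by apply: cvg_at_left_filter; exact: derivable1_continuous (dm _ x0t).
    have hm : \forall y \near x^'-, `|m x - m y| <= e / (w x + 1).
      exact: ((cvgrPdist_le _ _).1 cm _ e1).
    near=> y.
    have yx : y <= x by near: y; exact: nbhs_left_le.
    have H : `|m x - m y| <= e / (w x + 1) by near: y.
    have {}H := le_trans (ler_norm _) H.
    have h1 : w x * m x <= w y * m x by rewrite ler_wnM2r ?m0// wm.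
    have h2 : w y * (m x - m y) <= e.
      apply: (@le_trans _ _ (w y * (e / (w x + 1)))); first by rewrite ler_wpM2l.
      rewrite mulrCA ler_piMr ?(ltW e0)// ler_pdivrMr// mul1r.
      by rewrite (le_trans (wm _ _ yx))// lerDl.
    by lra.
(* Let a -> 0 and b -> tau in F_le: w(b) m(b) tends to 0, and leaving ]0, a]
   and ]b, tau[ out of the domain costs at most N times their length. *)
have fN_ge0 (N : nat) : 0 <= \int[lebesgue_measure]_(x in `]0, tau[) fN N x.
  have N0 : 0 <= N%:R :> R by [].
  have fN_ge x : - N%:R <= fN N x by rewrite /fN le_max lexx orbT.
  have sub_le a b : 0 < a -> a <= b -> b < tau ->
      \int[lebesgue_measure]_(x in `]a, b]) fN N x <=
      \int[lebesgue_measure]_(x in `]0, tau[) fN N x + N%:R * (a + (tau - b)).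
    move=> a0 ab bt.
    have b0 : 0 < b := lt_le_trans a0 ab.
    have i1 : (@lebesgue_measure R).-integrable `]0, b] (EFin \o fN N).
      by apply: integrableS (ifN N) => //; apply: subset_itvl; rewrite bnd_simp.
    have i2 : (@lebesgue_measure R).-integrable `]b, tau[ (EFin \o fN N).
      by apply: integrableS (ifN N) => //; apply: subset_itvr; rewrite bnd_simp ltW.
    have i3 : (@lebesgue_measure R).-integrable `]0, a] (EFin \o fN N).
      by apply: integrableS i1 => //; apply: subset_itvl; rewrite bnd_simp.
    rewrite -(@Rintegral_itvB _ _ (BRight 0) (BRight b) a)// ?bnd_simp ?(ltW a0)//.
    have := @Rintegral_itvB _ (fN N) (BRight 0) (BLeft tau) b (ifN N).
    rewrite !bnd_simp => /(_ (ltW b0) bt).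
    have h1 : - N%:R * (tau - b) <= \int[lebesgue_measure]_(x in `]b, tau[) fN N x.
      by apply: Rintegral_itv_ge => //; exact: ltW.
    have h2 : - N%:R * (a - 0) <= \int[lebesgue_measure]_(x in `]0, a]) fN N x.
      by apply: Rintegral_itv_ge => //; exact: ltW.
    by lra.
  apply/ler_addgt0Pr => e e0.
  have w1 : 0 < w tau + 1 by rewrite ltr_wpDl.
  have N1 : 0 < N%:R + 1 :> R by lra.
  have e1 : 0 < e / 3 / (w tau + 1) by rewrite !divr_gt0.
  have e2 : 0 < e / 3 / (N%:R + 1) by rewrite !divr_gt0.
  have Ne : N%:R * (e / 3 / (N%:R + 1)) <= e / 3.
    by rewrite mulrCA ler_piMr ?divr_ge0 ?(ltW e0)// ler_pdivrMr// mul1r lerDl.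
  have hm : \forall y \near tau^'-, `|0 - m y| <= e / 3 / (w tau + 1).
    exact: ((cvgrPdist_le _ _).1 mtau _ e1).
  pose a := Num.min (tau / 2) (e / 3 / (N%:R + 1)).
  have tau2 : 0 < tau / 2 by rewrite divr_gt0.
  have a0 : 0 < a by rewrite lt_min e2 tau2.
  have a_tau : a <= tau / 2 by rewrite /a ge_min lexx.
  have a_e : a <= e / 3 / (N%:R + 1) by rewrite /a ge_min lexx orbT.
  near tau^'- => b.
  have bt : b < tau by near: b; exact: nbhs_left_lt.
  have tb : tau / 2 <= b.
    by near: b; apply: nbhs_left_ge; rewrite ltr_pdivrMr// ltr_pMr// ltr1n.
  have H : `|0 - m b| <= e / 3 / (w tau + 1) by near: b.
  have be : tau - b < e / 3 / (N%:R + 1) by near: b; exact: nbhs_left_ltBl.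
  have ab : a <= b := le_trans a_tau tb.
  have bI : b \in `]0, tau[ by rewrite in_itv/= bt (lt_le_trans a0 ab).
  have aI : a \in `]0, tau[ by rewrite in_itv/= a0 (le_lt_trans ab bt).
  have h1 := F_le N _ _ a0 ab bt.
  have h2 := sub_le _ _ a0 ab bt.
  have h3 : w a * m a <= 0 by rewrite mulr_ge0_le0 ?m0.
  have h4 : w b * (0 - m b) <= e / 3.
    apply: (@le_trans _ _ (w b * (e / 3 / (w tau + 1)))).
      by rewrite ler_wpM2l// (le_trans (ler_norm _)).
    rewrite mulrCA ler_piMr ?divr_ge0 ?(ltW e0)// ler_pdivrMr// mul1r.
    by rewrite (le_trans (wm _ _ (ltW bt)))// lerDl.
  have h5 : N%:R * a <= e / 3 by apply: le_trans Ne; rewrite ler_wpM2l.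
  have h6 : N%:R * (tau - b) <= e / 3.
    by apply: le_trans Ne; rewrite ler_wpM2l// ltW.
  by lra.
have iabs : (@lebesgue_measure R).-integrable `]0, tau[ (fun x => `|(f x)%:E|)%E.
  exact: integrable_abse iff.
have fN_cvg x : (EFin \o fN N) x @[N --> \oo] --> (f x)%:E.
  apply: cvg_near_cst; near=> N; rewrite /= /fN; congr EFin.
  apply/max_idPl; rewrite lerNl (le_trans (ler_norm _))// normrN.
  by near: N; exact: nbhs_infty_ger.
have ae1 : {ae @lebesgue_measure R, forall x, `]0, tau[%classic x ->
    (EFin \o fN N) x @[N --> \oo] --> (EFin \o f) x}.
  by apply: aeW => x _; exact: fN_cvg.
have ae2 : {ae @lebesgue_measure R, forall x, forall N, `]0, tau[%classic x ->
    (`|(EFin \o fN N) x| <= `|(f x)%:E|)%E}.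
  by apply: aeW => x N _; rewrite lee_fin.
have mE N : measurable_fun `]0, tau[ (EFin \o fN N).
  by apply/measurable_EFinP; exact: mfN.
have mEf : measurable_fun `]0, tau[ (EFin \o f).
  by apply/measurable_EFinP; exact: mf.
have [_ _ cvgI] := @dominated_convergence _ _ _ (@lebesgue_measure R) `]0, tau[
  (measurable_itv _) (fun N => EFin \o fN N) (EFin \o f) (fun x => `|(f x)%:E|)%E
  mE mEf ae1 iabs ae2.
apply: fine_ge0; rewrite -(cvg_lim _ cvgI)//.
apply: lime_ge; first by apply/cvg_ex; eexists; exact: cvgI.
apply: nearW => N /=.
have fin : (\int[lebesgue_measure]_(x in `]0%R, tau[) (EFin \o fN N) x)%E
    \is a fin_num by apply: integrable_fin_num => //; exact: ifN.
by rewrite -(fineK fin) lee_fin; exact: fN_ge0.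
Unshelve. all: by end_near. Qed.

(** * Differentiability relative to a closed interval *)

Lemma differentiable_on_approx (R : realType) (J : set R) (f : R -> R) (x : R) :
  differentiable_on J f -> J x ->
  exists l : R, forall e, 0 < e -> exists2 d, 0 < d &
    forall y, `|y - x| < d -> y != x -> J y -> `|l - (f y - f x) / (y - x)| <= e.
Proof.
move=> df Jx; have /cvg_ex[/= l fl] := df x Jx.
exists l => e e0.
have H0 : \forall y \near within J x^', `|l - (f y - f x) / (y - x)| <= e.
  exact: ((cvgrPdist_le _ _).1 fl _ e0).
have /nbhs_ballP[d /= d0 hd] := H0.
by exists d => // y yx; apply: hd; rewrite /ball/= distrC.
Qed.

Lemma differentiable_on_derivable (R : realType) (a b x : R) (f : R -> R) :
  differentiable_on `[a, b] f -> x \in `]a, b[ -> derivable f x 1.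
Proof.
move=> df; rewrite in_itv/= => /andP[ax xb].
have Jx : `[a, b]%classic x by rewrite /= in_itv/= !ltW.
have [l hl] := differentiable_on_approx _ _ _ _ df Jx.
apply/cvg_ex; exists l; apply/cvgrPdist_le => e e0.
have [d d0 hd] := hl _ e0.
pose r := Num.min d (Num.min (x - a) (b - x)).
have r0 : 0 < r by rewrite !lt_min d0 !subr_gt0 ax xb.
apply/nbhs_ballP; exists r => //= h; rewrite /ball/= sub0r normrN !lt_min.
move=> /and3P[hdd ha hb] h0.
have := hd (h + x); rewrite addrK => /(_ hdd).
have -> : (h + x != x) by rewrite -subr_eq0 addrK.
rewrite /= in_itv/= /GRing.scale/= mulr1 => /(_ isT) H.
rewrite mulrC; apply: H; move: ha hb; rewrite !ltr_norml.
by move=> /andP[h1 h2] /andP[h3 h4]; apply/andP; split; lra.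
Qed.

Lemma differentiable_on_cvg_left (R : realType) (a b x : R) (f : R -> R) :
  differentiable_on `[a, b] f -> x \in `]a, b] -> f y @[y --> x^'-] --> f x.
Proof.
move=> df; rewrite in_itv/= => /andP[ax xb].
have Jx : `[a, b]%classic x by rewrite /= in_itv/= xb ltW.
have [l hl] := differentiable_on_approx _ _ _ _ df Jx.
have [d d0 hd] := hl _ ltr01.
apply/cvgrPdist_le => e e0.
have l1 : 0 < `|l| + 1 by rewrite ltr_wpDl.
have e1 : 0 < e / (`|l| + 1) by rewrite divr_gt0.
near=> y.
have yx : y < x by near: y; exact: nbhs_left_lt.
have xy0 : 0 < x - y by rewrite subr_gt0.
have ay : a <= y by near: y; exact: nbhs_left_ge.
have yd : x - y < d by near: y; exact: nbhs_left_ltBl.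
have ye : x - y < e / (`|l| + 1) by near: y; exact: nbhs_left_ltBl.
have := hd y; rewrite distrC (gtr0_norm xy0) => /(_ yd).
rewrite (lt_eqF yx) /= in_itv/= ay (le_trans (ltW yx) xb) => /(_ isT isT) H.
have {}H : `|(f y - f x) / (y - x)| <= `|l| + 1.
  rewrite -lerBlDl; apply: le_trans (lerB_dist _ _) _.
  by rewrite distrC.
rewrite normrM normfV (distrC y) (gtr0_norm xy0) ler_pdivrMr// in H.
rewrite distrC; apply: le_trans H _.
by rewrite mulrC -ler_pdivlMr// ltW.
Unshelve. all: by end_near. Qed.

(** * The extremum principle *)

Theorem theorem3p1 (R : realType) (B : R -> R) (alpha T : R)
    (alpha_gt0 : 0 < alpha) (alpha_lt1 : alpha < 1)
    (B_alpha_gt0 : 0 < B alpha) (B0 : B 0 = 1) (B1 : B 1 = 1)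
    (T_gt0 : 0 < T)
    (m : R -> R)
    (m_diff : differentiable_on `[0, T] m)
    (m_dom : H1 `]0, T[ m)
    (Dm_cont : {within `[0, T], continuous (ABC_derivative B alpha m)})
    (tau0 : R) (tau0_J : tau0 \in `]0, T])
    (m_tau0 : m tau0 = 0)
    (m_le0 : forall tau, tau \in `[0, tau0[ -> m tau <= 0) :
  0 <= ABC_derivative B alpha m tau0.
Proof.
have a1 : 0 < 1 - alpha by rewrite subr_gt0.
have lam0 : 0 <= alpha / (1 - alpha) by rewrite divr_ge0 ?ltW.
have a01 : 0 < alpha <= 1 by rewrite alpha_gt0 ltW.
have /andP[t0 tT] : (0 < tau0) && (tau0 <= T) by move: tau0_J; rewrite in_itv.
(* The maximum with 0 makes w monotone on the whole line, also beyond tau0. *)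
pose x sigma := alpha / (1 - alpha) * Num.max 0 (tau0 - sigma) `^ alpha.
pose w sigma := mittag_leffler alpha (- x sigma).
have x0 sigma : 0 <= x sigma by rewrite mulr_ge0 ?powR_ge0.
rewrite /ABC_derivative; apply: mulr_ge0; first by rewrite divr_ge0 ?ltW.
have : 0 <= \int[lebesgue_measure]_(s in `]0, tau0[) (w s * derive1 m s).
  apply: weighted_derive_integral_ge0.
  - exact: t0.
  - move=> s; rewrite in_itv/= => /andP[s0 st].
    apply: (differentiable_on_derivable _ _ _ _ _ m_diff).
    by rewrite in_itv/= s0 (lt_le_trans st).
  - move=> s; rewrite in_itv/= => /andP[s0 st].
    by apply: m_le0; rewrite in_itv/= st ltW.
  - by rewrite -m_tau0; exact: (differentiable_on_cvg_left _ _ _ _ _ m_diff).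
  - by move=> s; exact: mittag_leffler_ge0.
  - move=> s t st; apply: mittag_leffler_nonincreasing => //.
    have max_ge0 r : 0 <= Num.max 0 (tau0 - r) by rewrite le_max lexx.
    rewrite /x ler_wpM2l// ge0_ler_powR ?nnegrE ?(ltW alpha_gt0)//.
    by rewrite ge_max max_ge0/= le_max lerD2l lerN2 st orbT.
move=> /le_trans; apply; rewrite le_eqVlt; apply/orP; left; apply/eqP.
apply: eq_Rintegral => s; rewrite inE/= in_itv/= => /andP[s0 st].
congr (_ * _); rewrite /w /x; congr (mittag_leffler _ _).
by rewrite (max_idPr _) ?mulNr// subr_ge0 ltW.
Qed.
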